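(* Let $(X,T)$ be a uniquely ergodic dynamical system and let $\mu\in E(X,T)$. Then: (1) $(T,\mu)$ satisfies WLDT. (2) $(T|_{\mathrm{supp}(\mu)},\mu)$ satisfies LDT.
   Context: A dynamical system is a pair $(X,T)$ where $X$ is a compact metric space and $T:X\to X$ is continuous. $M(X)$ is the set of Borel probability measures on $X$, $M(X,T)$ the set of $T$-invariant ones, and $E(X,T)\subset M(X,T)$ the set of ergodic ones (every Borel $B$ with $T^{-1}(B)=B$ has $\mu(B)\in\{0,1\}$). $(X,T)$ is uniquely ergodic if $M(X,T)$ consists of a single point. $\mathrm{supp}(\mu)=\{x\in X:\mu(U)>0\text{ for any neighborhood }U\text{ of }x\}$; for $\mu\in M(X,T)$ it is a nonempty closed set with $T(\mathrm{supp}(\mu))\subset\mathrm{supp}(\mu)$ and $\mu(\mathrm{supp}(\mu))=1$, and in $(T|_{\mathrm{supp}(\mu)},\mu)$ the measure $\mu$ is restricted to the Borel subsets of $\mathrm{supp}(\mu)$. An observable is a function $\varphi\in C(X)$ (continuous, complex-valued). For a dynamical system $(X,T)$ and $\mu\in M(X)$, an observable $\varphi$ satisfies the large deviations theorem for $(T,\mu)$ if for any $\varepsilon>0$ there exists $h(\varepsilon)>0$ such that $$\mu\left(\left\{x\in X:\left|\frac{1}{n}\sum_{i=0}^{n-1}\varphi\circ T^{i}(x)-\int_X\varphi\,\mathrm{d}\mu\right|>\varepsilon\right\}\right)\le e^{-nh(\varepsilon)}$$ for all sufficiently large $n\in\mathbb{N}$. $(T,\mu)$ satisfies WLDT (the large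 deviations theorem of weak form) if every observable satisfies the large deviations theorem for $(T,\mu)$. $(T,\mu)$ satisfies LDT (the large deviations theorem) if it satisfies WLDT and $\mathrm{supp}(\mu)=X$. *)

(* Defs.v *)
From HB Require Import structures.
From mathcomp Require Import all_boot all_order all_algebra complex.
From mathcomp Require Import all_classical all_reals all_analysis.

Set Implicit Arguments.
Unset Strict Implicit.
Unset Printing Implicit Defensive.

Import Order.TTheory GRing.Theory Num.Theory.
Import numFieldNormedType.Exports.

Local Open Scope classical_set_scope.
Local Open Scope ring_scope.
Local Open Scope complex_scope.

HB.mixin Record isCompactSpace T & Topological T := {
  compact_space : compact [set: T]
}.

(* Measurable types of the library are pointed, so this structure only covers
   nonempty spaces; an empty space carries no probability measure. *)
#[short(type="compactMetricType")]
HB.structure Definition CompactMetric (R : realType) :=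
  { X of Metric R X & isPointed X & isCompactSpace X }.

Notation borel X := (g_sigma_algebraType (@open X)).

Section observables.
Context {R : realType} {X : compactMetricType R}.
Implicit Types (T : X -> X) (mu : probability (borel X) R) (phi : X -> R[i]).

Definition invariant_measures T : set (probability (borel X) R) :=
  [set mu | forall B : set (borel X), measurable B -> mu (T @^-1` B) = mu B].

Definition ergodic_measures T : set (probability (borel X) R) :=
  [set mu | invariant_measures T mu /\
    forall B : set (borel X), measurable B -> T @^-1` B = B ->
      mu B = 0%E \/ mu B = 1%E].

(* Library measures are total on [set X], with unconstrained values on
   non-Borel sets, so two of them are the same Borel measure when they agree on
   Borel sets (Leibniz equality would be too strong). *)
Definition uniquely_ergodic T : Prop :=
  exists2 mu, invariant_measures T mu &
    forall nu, invariant_measures T nu ->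
      forall B : set (borel X), measurable B -> nu B = mu B.

(* Open neighborhoods, since [mu] is only meaningful on Borel sets. *)
Definition supp mu : set X :=
  [set x | forall U : set X, open_nbhs x U -> (0 < mu U)%E].

Definition cintegral mu phi : R[i] :=
  (\int[mu]_x complex.Re (phi x)) +i* (\int[mu]_x complex.Im (phi x)).

Definition birkhoff_average T phi n (x : X) : R[i] :=
  n%:R^-1 * \sum_(i < n) phi (iter i T x).

Definition large_deviations T mu phi : Prop :=
  forall e : R, 0 < e -> exists2 h : R, 0 < h &
    \forall n \near \oo,
      (mu [set x | (e%:C < `|birkhoff_average T phi n x - cintegral mu phi|)%R]
        <= (expR (- (n%:R * h)))%:E)%E.

Definition WLDT T mu : Prop :=
  forall phi, continuous (phi : X -> R[i]^o) -> large_deviations T mu phi.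

Definition LDT T mu : Prop := WLDT T mu /\ supp mu = setT.

End observables.

Lemma ergodic_invariant {R : realType} {X : compactMetricType R} (T : X -> X) :
  ergodic_measures T `<=` invariant_measures T.
Proof. by move=> mu []. Qed.

Section support.
Context {R : realType} {X : compactMetricType R}.
Context (mu : probability (borel X) R).

Lemma open_borel (U : set X) : open U -> measurable (U : set (borel X)).
Proof. exact: sub_sigma_algebra. Qed.

Lemma supp_closed : closed (supp mu).
Proof.
move=> x clx U [oU Ux].
by have [y [sy Uy]] := clx U (open_nbhs_nbhs (conj oU Ux)); apply: sy.
Qed.

Lemma supp_borel : measurable (supp mu : set (borel X)).
Proof.
rewrite -(setCK (supp mu)); apply: measurableC; apply: open_borel.
exact: closed_openC supp_closed.
Qed.

Lemma supp_full : mu (supp mu) = 1%E.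
Proof.
have [B cB [oB bB]] := compact_second_countable (@compact_space _ X).
pose N := [set b | B b /\ mu b = 0%E].
have NE : ~` supp mu = \bigcup_(b in N) b.
  apply/seteqP; split=> [x /= nsx|x [b [Bb b0] bx] /= sx].
    have [U [oUx nU]] : exists U : set X, open_nbhs x U /\ ~ (0 < mu U)%E.
      apply: contrapT => nU; apply: nsx => U oUx; apply: contrapT => ?.
      by apply: nU; exists U.
    have [b [Bb bx] bU] := bB x U (open_nbhs_nbhs oUx).
    exists b => //; split=> //; apply/eqP; rewrite eq_le measure_ge0 andbT.
    rewrite (le_trans (le_measure mu _ _ bU)) ?inE//.
    - by apply: open_borel; exact: oB.
    - by apply: open_borel; exact: oUx.1.
    - by rewrite leNgt; apply/negP.
  by have := sx b (conj (oB _ Bb) bx); rewrite b0 ltxx.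
have N0 : mu (~` supp mu) = 0%E.
  suff : mu.-negligible (~` supp mu).
    by rewrite negligibleP//; apply: measurableC; exact: supp_borel.
  rewrite NE.
  have cN : countable N by apply: sub_countable cB; apply: subset_card_le => b [].
  move/pfcard_geP: cN => [->|[f]]; first by rewrite bigcup_set0; exact: negligible_set0.
  have -> : \bigcup_(b in N) b = \bigcup_n f n.
    apply/seteqP; split=> [x [b Nb bx]|x [n _ fx]].
      by have [n _ fn] := 'surj_f Nb; exists n; rewrite ?fn.
    by exists (f n) => //; exact: 'funS_f.
  apply: negligible_bigcup => n.
  have [Bfn fn0] : N (f n) by exact: 'funS_f.
  by apply/negligibleP => //; apply: open_borel; exact: oB.
by rewrite -(setCK (supp mu)) probability_setC ?N0 ?sube0//;
  apply: measurableC; exact: supp_borel.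
Qed.

Lemma supp_nonempty : supp mu !=set0.
Proof.
apply/set0P/eqP => s0; have := supp_full.
by rewrite s0 measure0 => /eqP; rewrite eq_sym onee_eq0.
Qed.

(* The subspace [supp mu] of [X], with the induced metric. *)
Definition supp_space : Type := set_type (supp mu).

Lemma supp_spaceP (x : supp_space) : supp mu (val x).
Proof. exact: set_mem (valP x). Qed.

HB.instance Definition _ := PseudoMetric.copy supp_space (set_type (supp mu)).

Let supp_dist (x y : supp_space) : R := mdist (val x) (val y).

Let supp_dist_ge0 x y : 0 <= supp_dist x y.
Proof. exact: mdist_ge0. Qed.

Let supp_dist_positivity x y : supp_dist x y = 0 -> x = y.
Proof. by move/mdist_positivity/val_inj. Qed.

Let supp_ballE (x : supp_space) d : ball x d = [set y | supp_dist x y < d].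
Proof.
have -> : ball x d = set_val @^-1` ball (set_val x) d by [].
by rewrite ballEmdist.
Qed.

HB.instance Definition _ := PseudoMetric_isMetric.Build R supp_space
  supp_dist_ge0 supp_dist_positivity supp_ballE.

HB.instance Definition _ := isPointed.Build supp_space
  (exist _ (projT1 (cid supp_nonempty)) (mem_set (projT2 (cid supp_nonempty)))).

Let supp_compact : compact [set: supp_space].
Proof.
have cs : compact (supp mu).
  exact: (subclosed_compact supp_closed (@compact_space _ X) (@subsetT _ _)).
move=> F PF FT.
pose G : set_system X := (val : supp_space -> X) @ F.
have Gs : G (supp mu).
  by apply: (@filterS _ F _ setT) FT => x _; exact: supp_spaceP.
have [p [sp clp]] := cs G _ Gs.
exists (exist _ p (mem_set sp)); split=> // A B FA [_ [[W oW <-]] /= Wp WB].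
have GA : G ((val : supp_space -> X) @` A).
  by apply: (@filterS _ F _ A) FA => x Ax; exists x.
have [_ [[a Aa <-] Wa]] := clp _ _ GA (open_nbhs_nbhs (conj oW Wp)).
by exists a; split=> //; exact: WB.
Qed.

HB.instance Definition _ := isCompactSpace.Build supp_space supp_compact.

(* [mu] restricted to the Borel subsets of [supp mu]. *)
Definition supp_measure (B : set (borel supp_space)) : \bar R :=
  mu ((val : supp_space -> X) @` B).

Lemma supp_space_borel (B : set (borel supp_space)) :
  measurable B -> measurable ((val : supp_space -> X) @` B : set (borel X)).
Proof.
pose G := [set B : set supp_space |
  measurable ((val : supp_space -> X) @` B : set (borel X))].
have vT : (val : supp_space -> X) @` setT = supp mu.
  apply/seteqP; split=> [_ [x _ <-]|x sx]; first exact: supp_spaceP.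
  by exists (exist _ x (mem_set sx)).
suff : <<s @open supp_space >> `<=` G by apply.
apply: smallest_sub; last first.
  move=> _ [W oW <-].
  have -> : G (set_val @^-1` W) = measurable ((supp mu : set (borel X)) `&` W).
    congr measurable; apply/seteqP; split=> [_ [x Wx <-]|x [sx Wx]].
      by split=> //; exact: supp_spaceP.
    by exists (exist _ x (mem_set sx)).
  by apply: measurableI; [exact: supp_borel|exact: open_borel].
split.
- by rewrite /G /= image_set0; exact: measurable0.
- move=> A GA; rewrite /G /=.
  have -> : (val : supp_space -> X) @` (setT `\` A) =
      supp mu `\` (val : supp_space -> X) @` A.
    apply/seteqP; split=> [_ [x [_ nAx] <-]|x [sx nAx]].
      by split; [exact: supp_spaceP|move=> [y Ay /val_inj yx]; apply: nAx; rewrite -yx].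
    exists (exist _ x (mem_set sx)) => //; split=> // Ax; apply: nAx.
    by exists (exist _ x (mem_set sx)).
  by apply: measurableD => //; exact: supp_borel.
- move=> F GF; rewrite /G /= image_bigcup.
  exact: bigcupT_measurable.
Qed.

Let supp_measure0 : supp_measure set0 = 0%E.
Proof. by rewrite /supp_measure image_set0 measure0. Qed.

Let supp_measure_ge0 B : (0 <= supp_measure B)%E.
Proof. exact: measure_ge0. Qed.

Let supp_measure_sigma_additive : semi_sigma_additive supp_measure.
Proof.
move=> F mF tF mUF; rewrite /supp_measure image_bigcup.
apply: measure_semi_sigma_additive.
- by move=> n; exact: supp_space_borel.
- move=> i j _ _ [_ [[x Fx <-] [y Fy /val_inj yx]]].
  by apply: tF => //; exists x; split=> //; rewrite -yx.
- by rewrite -image_bigcup; exact: supp_space_borel.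
Qed.

HB.instance Definition _ := isMeasure.Build _ _ _ supp_measure
  supp_measure0 supp_measure_ge0 supp_measure_sigma_additive.

Let supp_measure_setT : supp_measure setT = 1%E.
Proof.
rewrite /supp_measure -supp_full; congr (mu _).
apply/seteqP; split=> [_ [x _ <-]|x sx]; first exact: supp_spaceP.
by exists (exist _ x (mem_set sx)).
Qed.

HB.instance Definition _ := Measure_isProbability.Build _ _ _ supp_measure
  supp_measure_setT.

Context (T : X -> X) (cT : continuous T) (mT : invariant_measures T mu).

Lemma supp_stable x : supp mu x -> supp mu (T x).
Proof.
move=> sx U [oU UTx].
rewrite -mT; last exact: open_borel.
apply: sx; split=> //; apply: open_comp => // y _; exact: cT.
Qed.

Definition supp_map (x : supp_space) : supp_space :=
  exist _ (T (val x)) (mem_set (supp_stable (@supp_spaceP x))).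

Lemma supp_map_continuous : continuous supp_map.
Proof.
apply: continuous_comp_initial => x.
apply: (@continuous_comp _ _ _ set_val T); last exact: cT.
exact: initial_continuous.
Qed.

End support.

Arguments supp_measure {R X} mu B.

(* Main.v *)
(* The deviation set is empty for large n, since by unique ergodicity the
   Birkhoff averages converge uniformly.  Suppose that the averages of a
   continuous psi with values in [0, 1] exceed the integral of psi by e at points
   x_k and times n_k tending to infinity.  The limit L of the empirical measures
   of the orbits (x_k, n_k) along an ultrafilter is a T-invariant finitely
   additive probability on all subsets of X.  The outer measure built from inner
   approximations of open sets by closed sets gives a T-invariant Borel
   probability nu with L F <= nu F for all closed F; by uniqueness nu = mu.
   Slicing psi into N superlevel sets, which are closed, bounds the limit of its
   averages by 1/N plus the integral, a contradiction for N > 1/e.  The support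
   system inherits uniqueness: an invariant measure on it, pushed forward to X,
   is mu. *)

Require Import Defs.
From HB Require Import structures.
From mathcomp Require Import all_boot all_order all_algebra complex.
From mathcomp Require Import all_classical all_reals all_analysis.
From mathcomp Require Import measurable_realfun.

Set Implicit Arguments.
Unset Strict Implicit.
Unset Printing Implicit Defensive.

Import numFieldNormedType.Exports.

Local Open Scope classical_set_scope.
Local Open Scope ring_scope.

Import Order.TTheory GRing.Theory Num.Theory.

(** * Topological preliminaries *)

Lemma continuous_borel_measurable {X Y : ptopologicalType} (f : X -> Y) :
  continuous f -> measurable_fun [set: borel X] (f : borel X -> borel Y).
Proof.
move=> /continuousP cf.
apply: (@measurability _ _ (borel X) (borel Y) _ _ (@open Y)) => // _ [U oU <-].
by rewrite setTI; apply: sub_sigma_algebra; exact: cf.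
Qed.

(** Normality separates the disjoint closed sets [K \ U] and [K \ V] by disjoint open sets; removing
    one of these from [K] at a time gives the two pieces. This is what makes the inner content
    subadditive on open sets. *)
Lemma closed_split (R : realType) (X : compactMetricType R) (K U V : set X) :
  closed K -> open U -> open V -> K `<=` U `|` V ->
  exists K1 K2, [/\ closed K1, closed K2, K1 `<=` U, K2 `<=` V &
    K `<=` K1 `|` K2].
Proof.
move=> cK oU oV KUV.
have nX : normal_space X.
  exact: (compact_normal (@metric_hausdorff R X) (@compact_space R X)).
have /(normal_openP (R:=R)) /(_ (K `\` U) (K `\` V)) := nX.
case.
- by apply: closedI => //; exact: open_closedC.
- by apply: closedI => //; exact: open_closedC.
- by rewrite -setDUr setD_eq0.
move=> A [B [oA oB KA KB AB]].
exists (K `\` A), (K `\` B); split.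
- by apply: closedI => //; exact: open_closedC.
- by apply: closedI => //; exact: open_closedC.
- by move=> x [Kx nAx]; apply: contrapT => nUx; apply: nAx; exact: KA.
- by move=> x [Kx nBx]; apply: contrapT => nVx; apply: nBx; exact: KB.
- move=> x Kx; have [Ax|nAx] := pselect (A x); last by left.
  by right; split=> // Bx; have : (A `&` B) x by []; rewrite AB.
Qed.

(** * From a finitely additive content to a Borel probability *)

Section content_measure.
Context {R : realType} {X : compactMetricType R}.
Variable L : set X -> R.
Hypothesis L_ge0 : forall A, 0 <= L A.
Hypothesis LU : forall A B, A `&` B = set0 -> L (A `|` B) = L A + L B.
Hypothesis LT : L setT = 1.

Lemma content_le A B : A `<=` B -> L A <= L B.
Proof.
move=> AB; rewrite -(setDUK AB) LU ?lerDl//.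
by rewrite setDE setICA setICr setI0.
Qed.

Lemma content_set0 : L set0 = 0.
Proof.
have := LU (setI0 (@set0 X)); rewrite setU0 => /eqP.
by rewrite -subr_eq0 opprD addrA subrr add0r oppr_eq0 => /eqP.
Qed.

Lemma content_subadditive A B : L (A `|` B) <= L A + L B.
Proof.
have -> : A `|` B = A `|` (B `\` A) by rewrite setUDr setDv setD0.
by rewrite LU ?lerD2l ?content_le// setDE setICA setICr setI0.
Qed.

Local Open Scope ereal_scope.

(* Sets that are not open get [+oo], so that only covers by open sets count in
   the outer measure generated by [inner_content]. *)
Definition inner_content (U : set (borel X)) : \bar R :=
  if `[< open (U : set X) >] then
    ereal_sup [set (L K)%:E | K in [set K | closed K /\ K `<=` U]]
  else +oo.

Lemma le_inner_content (K U : set X) :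
  closed K -> K `<=` U -> (L K)%:E <= inner_content U.
Proof.
move=> cK KU; rewrite /inner_content; case: ifP => _; last by rewrite leey.
by apply: ereal_sup_ubound; exists K.
Qed.

Lemma inner_content_le (U : set X) x : open U ->
  (forall K, closed K -> K `<=` U -> (L K)%:E <= x) -> inner_content U <= x.
Proof.
move=> oU Ux; rewrite /inner_content (asboolT oU).
by apply: ge_ereal_sup => _ [K [cK KU] <-]; exact: Ux.
Qed.

Lemma inner_content_ge0 (U : set (borel X)) : 0 <= inner_content U.
Proof.
have := @le_inner_content set0 U closed0 (@sub0set _ U).
by rewrite content_set0.
Qed.

Lemma inner_content_set0 : inner_content set0 = 0.
Proof.
apply/eqP; rewrite eq_le inner_content_ge0 andbT.
apply: inner_content_le; first exact: open0.
by move=> K _; rewrite subset0 => ->; rewrite content_set0.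
Qed.

(** Induction on the cover: [closed_split] shares [K] between the first open set and the union of
    the others. *)
Lemma closed_le_sum_inner_content (B : nat -> set X) (s : seq nat) K :
  (forall i, open (B i)) -> closed K -> K `<=` \big[setU/set0]_(i <- s) B i ->
  (L K)%:E <= \sum_(i <- s) inner_content (B i).
Proof.
move=> oB; elim: s K => [|n s ih] K cK.
  by rewrite !big_nil subset0 => ->; rewrite content_set0.
rewrite !big_cons => Kn.
have oU : open (\big[setU/set0]_(i <- s) B i).
  by elim/big_ind : _ => //; [exact: open0|exact: openU].
have [K1 [K2 [cK1 cK2 K1n K2s KK]]] := closed_split cK (oB n) oU Kn.
rewrite (@le_trans _ _ ((L K1)%:E + (L K2)%:E))//.
  by rewrite -EFinD lee_fin (le_trans (content_le KK))// content_subadditive.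
by rewrite leeD// ?ih//; exact: le_inner_content.
Qed.

Definition content_outer : set (borel X) -> \bar R := mu_ext inner_content.

HB.instance Definition _ := isOuterMeasure.Build R (borel X) content_outer
  (mu_ext0 inner_content_set0 inner_content_ge0)
  (mu_ext_ge0 inner_content_ge0) (@le_mu_ext _ _ _ inner_content)
  (mu_ext_sigma_subadditive inner_content_ge0).

(** A cover with a non-open member has total content [+oo], so it never lowers the infimum and only
    open covers need testing. *)
Lemma content_outer_le_cover (A : set X) x :
  (forall B : nat -> set X, (forall i, open (B i)) ->
    A `<=` \bigcup_i B i -> x <= \sum_(i <oo) inner_content (B i)) ->
  x <= content_outer A.
Proof.
move=> xB; apply: le_ereal_inf_tmp => _ [B [mB AB] <-].
have [oB|/existsNP[i nBi]] := pselect (forall i, open (B i : set X)).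
  exact: xB.
rewrite (@eseries_pinfty _ _ xpredT i) ?leey//.
  by move=> n _; rewrite -ltNye (lt_le_trans _ (inner_content_ge0 _)).
by rewrite /inner_content asboolF.
Qed.

Lemma content_outer_le (U : set X) : open U ->
  content_outer U <= inner_content U.
Proof.
move=> oU; apply: ereal_inf_lbound.
exists (fun n => if n is 0%N then U : set (borel X) else set0).
  split; last by move=> x Ux; exists 0%N.
  by move=> [|i]//; exact: open_borel.
rewrite nneseries_recl//; last by move=> *; exact: inner_content_ge0.
rewrite eseries_cond/= eseries0 ?adde0// => -[|]//= k _ _.
exact: inner_content_set0.
Qed.

Lemma closed_le_content_outer (K : set X) : closed K ->
  (L K)%:E <= content_outer K.
Proof.
move=> cK; apply: content_outer_le_cover => B oB KB.
have : compact K by apply: subclosed_compact cK (@compact_space _ X) _.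
rewrite compact_cover => /(_ _ setT B (fun i _ => oB i) KB)[D _ KD].
(* Compactness gives a finite subcover indexed by [D]; [n] exceeds all its indices, so the first [n]
   sets already cover [K]. *)
pose n := (\max_(i <- finmap.enum_fset D) i).+1.
apply: le_trans (nneseries_lim_ge n _); last first.
  by move=> i _ _; exact: inner_content_ge0.
apply: closed_le_sum_inner_content => // x /KD[i /= iD Bx].
rewrite -bigcup_seq; exists i => //=.
by rewrite mem_index_iota ltnS leq0n/= leq_bigmax_seq.
Qed.

Lemma content_outer_setT : content_outer setT = 1.
Proof.
apply/eqP; rewrite eq_le; apply/andP; split.
  apply: (le_trans (@content_outer_le setT openT)).
  apply: inner_content_le; first exact: openT.
  by move=> K _ _; rewrite lee_fin -LT content_le.
by have := @closed_le_content_outer setT closedT; rewrite LT.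
Qed.

Lemma content_outer_le1 A : content_outer A <= 1.
Proof. by rewrite -content_outer_setT le_outer_measure. Qed.

Lemma content_outer_fin_num A : content_outer A \is a fin_num.
Proof.
rewrite ge0_fin_numE ?outer_measure_ge0//.
by rewrite (le_lt_trans (content_outer_le1 _)) ?ltry.
Qed.

(** Take a closed [K] inside the intersection of [U] and [O], then a closed [H] inside the open set
    [U \ K]. They are disjoint and their union is a closed subset of [U], so [L K + L H] is bounded
    by the inner content of [U]; suprema over [H], then over [K], give the claim. *)
Lemma content_outer_split (U O : set X) : open U -> open O ->
  content_outer (U `&` O) + content_outer (U `&` ~` O) <= inner_content U.
Proof.
move=> oU oO.
rewrite -leeBrDr ?content_outer_fin_num//.
have oUO : open (U `&` O) by exact: openI.
apply: (le_trans (content_outer_le oUO)).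
apply: inner_content_le => // K cK KUO.
rewrite leeBrDr ?content_outer_fin_num// addeC -leeBrDr//.
have oUK : open (U `\` K) by apply: openI => //; exact: closed_openC.
rewrite (@le_trans _ _ (content_outer (U `\` K)))//.
  by apply: le_outer_measure => x [Ux nOx]; split=> // /KUO[].
apply: (le_trans (content_outer_le oUK)).
apply: inner_content_le => // H cH HUK.
rewrite leeBrDr// -EFinD -LU; last first.
  by rewrite -subset0 => x [/HUK[_ nKx]].
apply: le_inner_content; first exact: closedU.
by move=> x [/HUK[]//|/KUO[]].
Qed.

(** Carathéodory-measurable sets form a sigma-algebra, so open sets suffice. For these,
    [content_outer_split] is applied to each member of an open cover and summed. *)
Lemma borel_caratheodory (B : set (borel X)) :
  measurable B -> content_outer.-caratheodory B.
Proof.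
suff : <<s @open X >> `<=` content_outer.-cara.-measurable by apply.
apply: smallest_sub; first exact: sigma_algebra_measurable.
move=> O oO; apply: le_caratheodory_measurable => A.
apply: content_outer_le_cover => B' oB AB.
apply: (@le_trans _ _ (\sum_(i <oo) content_outer (B' i `&` O) +
   \sum_(i <oo) content_outer (B' i `&` ~` O))).
  apply: leeD; (apply: (le_trans _ (outer_measure_sigma_subadditive _ _)));
  by apply: le_outer_measure; rewrite -setI_bigcupl; exact: setSI.
rewrite -nneseriesD; [|by move=> *; rewrite outer_measure_ge0..].
apply: lee_nneseries => n _ *; first by rewrite adde_ge0 ?outer_measure_ge0.
exact: content_outer_split.
Qed.

Definition content_measure (B : set (borel X)) : \bar R := content_outer B.

Let content_measure0 : content_measure set0 = 0.
Proof. exact: outer_measure0. Qed.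

Let content_measure_ge0 B : 0 <= content_measure B.
Proof. exact: outer_measure_ge0. Qed.

Let content_measure_sigma_additive : semi_sigma_additive content_measure.
Proof.
move=> F mF tF mUF.
apply: (@caratheodory_measure_sigma_additive _ _ content_outer) => //.
- by move=> n; apply: borel_caratheodory; exact: mF.
- exact: borel_caratheodory mUF.
Qed.

HB.instance Definition _ := isMeasure.Build _ _ _ content_measure
  content_measure0 content_measure_ge0 content_measure_sigma_additive.

HB.instance Definition _ := Measure_isProbability.Build _ _ _ content_measure
  content_outer_setT.

(** The union of an open cover of [A] whose total content is within [e] of the infimum serves as
    [U]. *)
Lemma content_outer_regular A (e : R) : (0 < e)%R ->
  exists U : set X, [/\ open U, A `<=` U &
    content_outer U <= content_outer A + e%:E].
Proof.
move=> e0; apply: contrapT => nU.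
suff : content_outer A + e%:E <= content_outer A.
  by rewrite -leeBrDl ?content_outer_fin_num// subee ?content_outer_fin_num//
    lee_fin leNgt e0.
apply: content_outer_le_cover => B oB AB.
apply/ltW; rewrite ltNge; apply/negP => Be.
apply: nU; exists (\bigcup_i B i); split => //; first exact: bigcup_open.
apply: le_trans Be; apply: (le_trans (outer_measure_sigma_subadditive _ _)).
apply: lee_nneseries => i _ *; first exact: outer_measure_ge0.
exact: content_outer_le.
Qed.

Section invariant.
Variable T : X -> X.
Hypothesis cT : continuous T.
Hypothesis LTinv : forall A, L (T @^-1` A) = L A.

(** Open sets are stable under intersection and generate the Borel sets, so it suffices to compare
    the measure with its image under [T] on them. One inequality is proved for open sets, and the
    same one for closed sets; complements turn the latter into the converse for open sets. *)
Lemma content_measure_invariant (B : set (borel X)) : measurable B ->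
  content_measure (T @^-1` B) = content_measure B.
Proof.
have mT := continuous_borel_measurable cT.
(* A closed subset of [U] pulls back to a closed subset of the preimage of [U] with the same [L]. *)
have leU (U : set X) : open U ->
    content_measure U <= content_measure (T @^-1` U).
  move=> oU; apply: (le_trans (content_outer_le oU)).
  apply: inner_content_le => // K cK KU; rewrite -LTinv.
  have cTK : closed (T @^-1` K) by apply: closed_comp => // x _; exact: cT.
  apply: (le_trans (closed_le_content_outer cTK)); apply: le_outer_measure.
  by move=> x /KU.
have leC (F : set X) : closed F ->
    content_measure F <= content_measure (T @^-1` F).
  move=> cF; apply/lee_addgt0Pr => e e0.
  have [W [oW FW We]] := content_outer_regular (T @^-1` F) e0.
  (* [T] is a closed map, so a neighborhood of the fibre [T @^-1` F] contains
     the preimage of a neighborhood of [F]. *)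
  pose V := ~` (T @` (~` W)).
  have oV : open V.
    apply: closed_openC; apply: (compact_closed (@metric_hausdorff R X)).
    apply: continuous_compact; first exact: continuous_subspaceT.
    apply: subclosed_compact (@compact_space R X) _ => //.
    exact: open_closedC.
  apply: le_trans We; apply: (@le_trans _ _ (content_measure V)).
    apply: le_outer_measure => y Fy [x nWx Txy].
    by apply: nWx; apply: FW; rewrite /= Txy.
  apply: (le_trans (leU _ oV)); apply: le_outer_measure => x /= VTx.
  by apply: contrapT => nWx; apply: VTx; exists x.
pose m : probability (borel X) R := content_measure.
pose g : {mfun borel X >-> borel X} := mfun_Sub (mem_set mT).
move=> mB; apply/esym; suff : m B = distribution m g B by [].
apply: (@measure_unique _ R (borel X) (@open X) (fun=> setT) _ _ _ _
  m (distribution m g) _ _ B mB).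
- by [].
- by move=> ? ?; exact: openI.
- by move=> _; exact: openT.
- by apply/seteqP; split=> // x _; exists 0%N.
- move=> U oU; apply/eqP; rewrite eq_le leU//=.
  have mU : measurable (U : set (borel X)) by exact: open_borel.
  have mTU : measurable (T @^-1` U : set (borel X)).
    by apply: open_borel; apply: open_comp => // x _; exact: cT.
  have : m (~` U) <= m (~` (T @^-1` U)) by exact: leC (open_closedC oU).
  suff : m (~` U) <= m (~` (T @^-1` U)) -> m (T @^-1` U) <= m U by [].
  rewrite !probability_setC//.
  rewrite -(fineK (fin_num_measure m _ mU)) -(fineK (fin_num_measure m _ mTU)).
  by rewrite -!EFinB !lee_fin lerD2l lerN2.
- by move=> _; exact: (le_lt_trans (content_outer_le1 _) (ltry 1%R)).
Qed.

Lemma invariant_measure_of_content : exists2 nu : probability (borel X) R,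
  invariant_measures T nu & forall F, closed F -> (L F)%:E <= nu F.
Proof.
exists content_measure; first exact: content_measure_invariant.
exact: closed_le_content_outer.
Qed.

End invariant.
End content_measure.

(** * Ultralimits of empirical measures *)

Lemma ultrafilter_bounded_cvg {R : realType} (I : Type) (U : set_system I)
    (f : I -> R) (a b : R) :
  UltraFilter U -> (forall i, a <= f i <= b) -> cvg (f i @[i --> U]).
Proof.
move=> uU fab; have pU : ProperFilter U by exact: ultra_proper.
have [|p [_ clp]] := @segment_compact R a b (f i @[i --> U]) _.
  by apply: (@filterE _ U) => i; rewrite /= in_itv/= fab.
apply/cvg_ex; exists p => V /= Vp.
(* An ultrafilter converges to each of its cluster points: otherwise the complement of the preimage
   of [V] would belong to [U], and its image would miss the neighborhood [V] of [p]. *)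
have [//|nV] := in_ultra_setVsetC (f @^-1` V) uU.
by have [z []] := clp (~` V) V nV Vp.
Qed.

Section empirical.
Context {R : realType} {X : Type} (T : X -> X).
Implicit Types (A B : set X) (n : nat) (x : X).

Definition average (psi : X -> R) n x : R :=
  n%:R^-1 * \sum_(i < n) psi (iter i T x).

(** The uniform measure on the first [n] points of the orbit of [x]; for [n = 0] it is the zero
    measure, as the inverse of 0 is 0. *)
Definition empirical n x A : R := average \1_A n x.

Lemma empirical_ge0 n x A : 0 <= empirical n x A.
Proof. by rewrite /empirical mulr_ge0// sumr_ge0// => i _; rewrite indicE. Qed.

Lemma empirical_le1 n x A : empirical n x A <= 1.
Proof.
rewrite /empirical /average; have [->|n0] := posnP n.
  by rewrite invr0 mul0r.
rewrite ler_pdivrMl ?ltr0n// mulr1 -[leRHS]mulr1 mulr_natl.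
by rewrite -[n in leRHS]card_ord -sumr_const ler_sum.
Qed.

Lemma empiricalU n x A B : A `&` B = set0 ->
  empirical n x (A `|` B) = empirical n x A + empirical n x B.
Proof.
move=> AB; rewrite /empirical /average -mulrDr -big_split/=; congr (_ * _).
apply: eq_bigr => i _; rewrite !indicE in_setU.
have : ~~ ((iter i T x \in A) && (iter i T x \in B)).
  by rewrite -in_setI AB in_set0.
by case: (_ \in A); case: (_ \in B); rewrite //= ?addr0 ?add0r.
Qed.

Lemma empirical_setT n x : (0 < n)%N -> empirical n x setT = 1.
Proof.
move=> n0; rewrite /empirical /average indicT /= sumr_const card_ord.
by rewrite mulVf// pnatr_eq0 -lt0n.
Qed.

(** The difference telescopes, leaving only the two ends of the orbit. *)
Lemma empirical_preimage n x A :
  `|empirical n x (T @^-1` A) - empirical n x A| <= n%:R^-1.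
Proof.
rewrite /empirical /average -mulrBr normrM ger0_norm// -[leRHS]mulr1.
rewrite ler_wpM2l// -sumrB.
have -> : \sum_(i < n) (\1_(T @^-1` A) (iter i T x) - \1_A (iter i T x)) =
    \1_A (iter n T x) - \1_A x :> R.
  rewrite -(big_mkord xpredT
    (fun i => \1_(T @^-1` A) (iter i T x) - \1_A (iter i T x))).
  by rewrite (telescope_sumr_eq (fun i => \1_A (iter i T x)))//.
by rewrite !indicE; case: (_ \in A); case: (_ \in A);
  rewrite ?subrr ?subr0 ?sub0r ?normrN ?normr1 ?normr0.
Qed.

(** The ultrafilter refines the filter of eventual properties, so limits at infinity persist along
    it. The bound [k < n k] makes every [n k] positive, hence total mass 1, and sends the invariance
    defect, at most the inverse of [n k], to 0. *)
Lemma empirical_ultralimit (n : nat -> nat) (x : nat -> X) :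
  (forall k, k < n k)%N ->
  exists (U : set_system nat) (L : set X -> R),
    [/\ ProperFilter U,
        (forall A, empirical (n k) (x k) A @[k --> U] --> L A),
        (forall A, 0 <= L A) /\ L setT = 1,
        (forall A B, A `&` B = set0 -> L (A `|` B) = L A + L B) &
        (forall A, L (T @^-1` A) = L A)].
Proof.
move=> kn; have [U [uU ooU]] := ultraFilterLemma (eventually_filter).
have pU : ProperFilter U by exact: ultra_proper.
pose L A := lim (empirical (n k) (x k) A @[k --> U]).
have LP A : empirical (n k) (x k) A @[k --> U] --> L A.
  apply: (@ultrafilter_bounded_cvg _ _ _ _ 0 1) => // k.
  by rewrite empirical_ge0 empirical_le1.
have LE A (l : R) : empirical (n k) (x k) A @[k --> U] --> l -> L A = l.
  by move=> /cvg_lim; apply.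
exists U, L; split=> //.
- split=> [A|].
    apply: limr_ge; first by apply/cvg_ex; exists (L A).
    by apply: filterE => k; exact: empirical_ge0.
  apply: LE; under eq_fun do rewrite empirical_setT ?(leq_trans _ (kn _))//.
  exact: cvg_cst.
- move=> A B AB; apply: LE; under eq_fun do rewrite empiricalU//.
  exact: cvgD.
- move=> A; apply: LE.
  have d0 : empirical (n k) (x k) (T @^-1` A) - empirical (n k) (x k) A
      @[k --> U] --> (0 : R).
    apply: (@cvg_trans _ ((empirical (n k) (x k) (T @^-1` A) -
      empirical (n k) (x k) A) @[k --> \oo])); first exact: cvg_app.
    apply/cvgr0Pnorm_le => e e0; near=> k.
    apply: (le_trans (empirical_preimage _ _ _)).
    rewrite (@le_trans _ _ (k.+1%:R^-1))//.
      by rewrite lef_pV2 ?posrE ?ltr0n ?ler_nat// (leq_trans _ (kn _)).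
    apply: ltW; near: k; exact: (near_infty_natSinv_lt (PosNum e0)).
  rewrite -[X in _ --> X]add0r; apply: cvg_trans (cvgD d0 (LP A)).
  by apply: near_eq_cvg; apply: filterE => k; rewrite /= subrK.
Unshelve. all: by end_near. Qed.

End empirical.

(** * Superlevel slicing and integrals of continuous functions *)

Lemma layer_cake (R : realType) (N : nat) (y : R) : 0 <= y <= 1 ->
  \sum_(j < N) (j.+1%:R <= N%:R * y)%R%:R <= N%:R * y
    <= 1 + \sum_(j < N) (j.+1%:R <= N%:R * y)%R%:R.
Proof.
move=> /andP[y0 y1]; have Ny0 : 0 <= N%:R * y by rewrite mulr_ge0.
have NyN : (Num.truncn (N%:R * y) <= N)%N.
  by rewrite -ltnS truncn_lt_nat// (@le_lt_trans _ _ N%:R) ?ltr_nat// ler_piMr.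
(* The indices counted are those below the integer part of [N * y]; since [y <= 1], that part is at
   most [N] and none is cut off. *)
suff -> : \sum_(j < N) (j.+1%:R <= N%:R * y)%R%:R =
    (Num.truncn (N%:R * y))%:R :> R.
  rewrite nat1r; apply/andP; split; first by rewrite truncn_le.
  by apply: ltW; exact: truncnS_gt.
under eq_bigr do rewrite -truncn_gt_nat.
rewrite -natr_sum -[in RHS](card_ord (Num.truncn _)) -sum1_card.
rewrite (big_ord_widen N (fun=> 1%N))//; congr (_%:R).
by rewrite [RHS]big_mkcond; apply: eq_bigr => i _; case: ltnP.
Qed.

Section continuous_observable.
Context {R : realType} {X : compactMetricType R}.
Variable mu : probability (borel X) R.
Implicit Types psi : X -> R.

Lemma continuous_measurable_real psi :
  continuous psi -> measurable_fun [set: borel X] psi.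
Proof.
move=> /continuousP cpsi.
apply: (measurability _ (RGenOpens.measurableE R)).
move=> _ [_ [a [b ->] <-]]; rewrite setTI; apply: open_borel.
exact/cpsi/interval_open.
Qed.

Lemma continuous_bound psi : continuous psi ->
  exists2 M, 0 < M & forall x, `|psi x| <= M.
Proof.
move=> cpsi.
have : compact (psi @` setT).
  apply: continuous_compact; first exact: continuous_subspaceT.
  exact: compact_space.
move=> /compact_bounded[M [_ Mpsi]]; exists (`|M| + 1) => [|x].
  by rewrite ltr_wpDl.
have M1 : M < `|M| + 1 by rewrite (le_lt_trans (ler_norm _))// ltrDl.
by apply: (Mpsi _ M1 (psi x)); exists x.
Qed.

Lemma continuous_integrable psi :
  continuous psi -> mu.-integrable setT (EFin \o psi).
Proof.
move=> cpsi; apply: measurable_bounded_integrable => //.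
- exact: (le_lt_trans (probability_le1 mu _) (ltry 1)).
- exact: continuous_measurable_real.
- have [M _ psiM] := continuous_bound cpsi.
  exists M; split=> [|z Mz x _ /=]; first exact: num_real.
  by rewrite (le_trans (psiM x))// ltW.
Qed.

(** The lower bound of [layer_cake], integrated against [mu]. *)
Lemma sum_superlevel_le_integral psi (N : nat) : continuous psi ->
  (forall x, 0 <= psi x <= 1) ->
  \sum_(j < N) fine (mu [set x | j.+1%:R <= N%:R * psi x]) <=
    N%:R * \int[mu]_x psi x.
Proof.
move=> cpsi psi01.
pose F (j : nat) : set (borel X) := [set x | j.+1%:R <= N%:R * psi x].
have mF j : measurable (F j).
  have -> : F j = setT `&` (fun x => N%:R * psi x) @^-1` `[j.+1%:R, +oo[.
    by rewrite setTI; apply/seteqP; split => x /=; rewrite in_itv/= andbT.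
  have : measurable_fun [set: borel X] (fun x => N%:R * psi x).
    by apply: measurable_funM => //; exact: continuous_measurable_real.
  by apply => //; exact: measurable_itv.
have ipsi := continuous_integrable cpsi.
rewrite -RintegralZl// -lee_fin -sumEFin.
rewrite fineK; last first.
  apply: integrable_fin_num => //; apply: continuous_integrable => x.
  by apply: cvgM; [exact: cvg_cst|exact: cpsi].
rewrite (eq_bigr (fun j : 'I_N => mu (F j))); last first.
  by move=> j _; rewrite fineK//; apply: fin_num_measure; exact: mF.
have -> : (\sum_(j < N) mu (F j) =
    \int[mu]_x (\sum_(j < N) (\1_(F j) x)%:E))%E.
  rewrite ge0_integral_sum//.
  - by apply: eq_bigr => j _; rewrite integral_indic// setIT.
  - move=> j; apply/measurable_EFinP; exact: measurable_indic.
apply: ge0_le_integral => //.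
- by move=> x _; rewrite sume_ge0.
- by apply: emeasurable_sum => j; apply/measurable_EFinP; exact: measurable_indic.
- apply/measurable_EFinP.
  by apply: measurable_funM => //; exact: continuous_measurable_real.
- move=> x _; rewrite sumEFin lee_fin.
  have /andP[+ _] := layer_cake N (psi01 x).
  by apply: le_trans; rewrite ler_sum// => j _; rewrite indicE mem_setE.
Qed.

End continuous_observable.

(** * Uniform convergence of real Birkhoff averages *)

Section unique_ergodicity.
Context {R : realType} {X : compactMetricType R}.
Variables (T : X -> X) (mu : probability (borel X) R).
Hypothesis cT : continuous T.
Hypothesis mu_unique : forall nu, invariant_measures T nu ->
  forall B : set (borel X), measurable B -> nu B = mu B.
Implicit Types psi : X -> R.

(** The upper bound of [layer_cake], averaged along the orbit. *)
Lemma average_le_empirical psi n x (N : nat) : (0 < N)%N ->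
  (forall x, 0 <= psi x <= 1) -> average T psi n x <=
    N%:R^-1 * (1 +
      \sum_(j < N) empirical T n x [set x | j.+1%:R <= N%:R * psi x]).
Proof.
move=> N0 psi01; rewrite ler_pdivlMl ?ltr0n//.
have [->|n0] := posnP n.
  by rewrite /average invr0 mul0r mulr0 addr_ge0// sumr_ge0// => j _;
     exact: empirical_ge0.
rewrite /average mulrCA ler_pdivrMl ?ltr0n// mulrDr mulr1.
under eq_bigr do rewrite /empirical /average.
rewrite -mulr_sumr mulVKf ?pnatr_eq0 -?lt0n// exchange_big/= mulr_sumr.
have -> : n%:R = \sum_(i < n) 1 :> R by rewrite sumr_const card_ord.
rewrite -big_split/=.
apply: ler_sum => i _; have /andP[_] := layer_cake N (psi01 (iter i T x)).
by under [X in _ -> _ <= _ + X]eq_bigr do rewrite indicE mem_setE.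
Qed.

Lemma average_eventually_le01 psi e : continuous psi ->
  (forall x, 0 <= psi x <= 1) -> 0 < e ->
  \forall n \near \oo, forall x, average T psi n x <= \int[mu]_x psi x + e.
Proof.
move=> cpsi psi01 e0; apply: contrapT => nev.
have bad k : exists p : nat * X, (k < p.1)%N /\
    \int[mu]_x psi x + e < average T psi p.1 p.2.
  apply: contrapT => nbad; apply: nev; exists k.+1 => // n /= kn x.
  rewrite leNgt; apply/negP => lt_avg; apply: nbad.
  by exists (n, x).
have [p Hp] := choice bad.
have [U [L [pU LP [L_ge0 LT] LU LTinv]]] :=
  @empirical_ultralimit R X T (fun k => (p k).1) (fun k => (p k).2)
    (fun k => (Hp k).1).
have [nu nuT Lnu] := invariant_measure_of_content L_ge0 LU LT cT LTinv.
(* [N] exceeds the inverse of [e], so the slicing error [1/N] is strictly below [e]. *)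
pose N := (Num.truncn e^-1).+1.
have N0 : 0 < N%:R :> R by rewrite ltr0n.
have Ne : N%:R^-1 < e by rewrite invf_plt ?posrE// truncnS_gt.
pose F (j : nat) : set X := [set x | j.+1%:R <= N%:R * psi x].
have cF j : closed (F j).
  have -> : F j = (fun x => N%:R * psi x) @^-1` [set y | j.+1%:R <= y] by [].
  apply: closed_comp => [x _|]; last exact: closed_ge.
  by apply: cvgM; [exact: cvg_cst|exact: cpsi].
have LF j : L (F j) <= fine (mu (F j)).
  have mF : measurable (F j : set (borel X)).
    rewrite -(setCK (F j)); apply: measurableC; apply: open_borel.
    exact: closed_openC (cF j).
  rewrite -lee_fin fineK ?fin_num_measure// -(mu_unique nuT mF).
  exact: Lnu.
have lim_upper : N%:R^-1 * (1 + \sum_(j < N) empirical T (p k).1 (p k).2 (F j))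
    @[k --> U] --> N%:R^-1 * (1 + \sum_(j < N) L (F j)).
  apply: cvgM; first exact: cvg_cst.
  apply: cvgD; first exact: cvg_cst.
  by apply: cvg_big => [|j _]; [exact: add_continuous|exact: LP].
have : \int[mu]_x psi x + e <= N%:R^-1 * (1 + \sum_(j < N) L (F j)).
  apply: ler_cvg_to (cvg_cst _) lim_upper _; apply: filterE => k.
  by rewrite (le_trans (ltW (Hp k).2))//; exact: average_le_empirical.
(* After multiplying by [N], the sum of the [L (F j)] is at most [N] times the integral, and
   [1 < N * e]. *)
apply/negP; rewrite -ltNge ltr_pdivrMl// mulrDr addrC.
apply: ler_ltD; last by rewrite -ltr_pdivrMl ?mulr1.
apply: (le_trans _ (sum_superlevel_le_integral mu N cpsi psi01)).
by apply: ler_sum => j _; exact: LF.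
Qed.

Lemma average_eventually_le psi e : continuous psi -> 0 < e ->
  \forall n \near \oo, forall x, average T psi n x <= \int[mu]_x psi x + e.
Proof.
move=> cpsi e0; have [M M0 psiM] := continuous_bound cpsi.
have M20 : 0 < 2 * M by rewrite mulr_gt0.
(* Affine rescaling from [[-M, M]] to [[0, 1]]; the tolerance is scaled by the same factor. *)
pose g x := (2 * M)^-1 * (psi x + M).
have cg : continuous g.
  move=> x; apply: cvgM; first exact: cvg_cst.
  by apply: cvgD; [exact: cpsi|exact: cvg_cst].
have g01 x : 0 <= g x <= 1.
  have := psiM x; rewrite ler_norml => /andP[Mpsi psi_M]; apply/andP; split.
    apply: mulr_ge0; first by rewrite invr_ge0 ltW.
    by rewrite -lerBlDr sub0r.
  by rewrite ler_pdivrMl// mulr1 mulr_natl mulr2n lerD2r.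
have eM : 0 < (2 * M)^-1 * e by rewrite mulr_gt0 ?invr_gt0.
have intg : \int[mu]_x g x = (2 * M)^-1 * (\int[mu]_x psi x + M).
  have icst : mu.-integrable setT (EFin \o cst M).
    by apply: continuous_integrable; exact: cst_continuous.
  have ipsi := continuous_integrable mu cpsi.
  rewrite /g RintegralZl//; last first.
    apply: continuous_integrable => x.
    by apply: cvgD; [exact: cpsi|exact: cvg_cst].
  rewrite RintegralD// Rintegral_cst//.
  by rewrite [X in fine X](_ : _ = 1%E) ?mulr1//; exact: probability_setT.
have := average_eventually_le01 cg g01 eM.
(* Only for nonzero [n] is the average of the constant [M] equal to [M]. *)
apply: filter_app; exists 1%N => // n /= n0 avg x.
have := avg x; rewrite intg -mulrDr /average /g -mulr_sumr mulrCA.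
rewrite ler_pM2l ?invr_gt0// big_split/= sumr_const card_ord mulrDr.
by rewrite -[M *+ n]mulr_natl mulKf ?pnatr_eq0 -?lt0n// addrAC lerD2r.
Qed.

(** The lower bound is the upper bound for [- psi]. *)
Lemma average_eventually_near psi e : continuous psi -> 0 < e ->
  \forall n \near \oo, forall x,
    `|average T psi n x - \int[mu]_x psi x| <= e.
Proof.
move=> cpsi e0.
have cNpsi : continuous (fun x => - psi x) by move=> x; apply: cvgN; exact: cpsi.
have intN : \int[mu]_x - psi x = - \int[mu]_x psi x.
  under eq_Rintegral do rewrite -mulN1r.
  by rewrite RintegralZl ?mulN1r//; exact: continuous_integrable.
near=> n => x; rewrite ler_norml lerBrDr lerBlDl; apply/andP; split.
  have : average T (fun x => - psi x) n x <= \int[mu]_x - psi x + e.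
    by move: x; near: n; exact: average_eventually_le.
  by rewrite intN /average sumrN mulrN lerNl opprD opprK addrC.
by move: x; near: n; exact: average_eventually_le.
Unshelve. all: by end_near. Qed.

End unique_ergodicity.

(** * Complex observables and the weak large deviations theorem *)

Local Open Scope complex_scope.

Lemma ler_Re_norm (R : rcfType) (z : R[i]) : (`|complex.Re z|)%:C <= `|z|.
Proof.
case: z => a b; rewrite normc_def lecR -sqrtr_sqr ler_wsqrtr//.
by rewrite lerDl sqr_ge0.
Qed.

Lemma ler_Im_norm (R : rcfType) (z : R[i]) : (`|complex.Im z|)%:C <= `|z|.
Proof.
case: z => a b; rewrite normc_def lecR -sqrtr_sqr ler_wsqrtr//.
by rewrite lerDr sqr_ge0.
Qed.

Lemma ler_norm_ReIm (R : rcfType) (z : R[i]) :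
  `|z| <= (`|complex.Re z| + `|complex.Im z|)%:C.
Proof.
case: z => a b; rewrite normc_def lecR /= -[leRHS]ger0_norm ?addr_ge0//.
rewrite -[leRHS]sqrtr_sqr ler_wsqrtr// sqrrD !real_normK ?num_real//.
by rewrite addrAC lerDl mulrn_wge0// mulr_ge0.
Qed.

(** Such a [part] is 1-Lipschitz; it stands for both the real and the imaginary part. *)
Lemma continuous_complex_part (R : realType) (Y : topologicalType)
    (part : R[i] -> R) (phi : Y -> R[i]) :
  {morph part : z w / z - w} -> (forall z, (`|part z|)%:C <= `|z|) ->
  continuous (phi : Y -> R[i]^o) -> continuous (part \o phi).
Proof.
move=> partB part_le cphi y; apply/cvgrPdist_lt => e e0.
have eC : 0 < e%:C :> R[i] by rewrite ltcR.
have /cvgrPdist_lt /(_ _ eC) := cphi y; apply: filterS => z phi_lt.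
rewrite -ltcR (le_lt_trans _ phi_lt)//.
by rewrite /= -partB; exact: part_le.
Qed.

Section WLDT.
Context {R : realType} {X : compactMetricType R}.
Variables (T : X -> X) (mu : probability (borel X) R).

Lemma birkhoff_average_Re (phi : X -> R[i]) n x :
  complex.Re (birkhoff_average T phi n x) =
  average T (@complex.Re R \o phi) n x.
Proof.
rewrite /birkhoff_average /average /= -(raddf_sum (@complex.Re R)).
have -> : n%:R^-1 = (n%:R^-1)%:C :> R[i] by rewrite fmorphV rmorph_nat.
by case: (\sum_(i < n) _) => a b /=; rewrite mul0r subr0.
Qed.

Lemma birkhoff_average_Im (phi : X -> R[i]) n x :
  complex.Im (birkhoff_average T phi n x) =
  average T (@complex.Im R \o phi) n x.
Proof.
rewrite /birkhoff_average /average /= -(raddf_sum (@complex.Im R)).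
have -> : n%:R^-1 = (n%:R^-1)%:C :> R[i] by rewrite fmorphV rmorph_nat.
by case: (\sum_(i < n) _) => a b /=; rewrite mul0r addr0.
Qed.

Lemma unique_invariant_WLDT : continuous T ->
  (forall nu, invariant_measures T nu ->
    forall B : set (borel X), measurable B -> nu B = mu B) ->
  WLDT T mu.
Proof.
(* Any positive rate would do, as the deviation set is eventually empty. *)
move=> cT mu_unique phi cphi e e0; exists 1 => //.
have e20 : 0 < e / 2 by rewrite divr_gt0.
have cRe : continuous (@complex.Re R \o phi).
  by apply: continuous_complex_part cphi => [z w|z];
    [exact: raddfB|exact: ler_Re_norm].
have cIm : continuous (@complex.Im R \o phi).
  by apply: continuous_complex_part cphi => [z w|z];
    [exact: raddfB|exact: ler_Im_norm].
have nRe := average_eventually_near cT mu_unique cRe e20.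
have nIm := average_eventually_near cT mu_unique cIm e20.
near=> n.
rewrite (_ : [set x | _] = set0) ?measure0 ?lee_fin ?expR_ge0//.
apply/seteqP; split=> // x /=; apply/negP/negbT/le_gtF.
apply: (le_trans (ler_norm_ReIm _)); rewrite lecR [leRHS]splitr.
rewrite !raddfB/= birkhoff_average_Re birkhoff_average_Im.
by apply: lerD; move: x; near: n.
Unshelve. all: by end_near. Qed.

End WLDT.

(** * The system on the support *)

Section support_system.
Context {R : realType} {X : compactMetricType R}.
Context (mu : probability (borel X) R).

Lemma supp_val_continuous : continuous (val : supp_space mu -> X).
Proof. by move=> x; exact: initial_continuous. Qed.

(** An open set of the subspace is the trace of an open [W] of [X], and the trace has the same mass
    as [W] because [mu] vanishes off its support. *)
Lemma supp_supp_measure : supp (supp_measure mu) = setT.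
Proof.
apply/seteqP; split=> // x _ _ [[W oW <-] Wx].
have mW : measurable (W : set (borel X)) by exact: open_borel.
have mS := supp_borel mu.
have := @supp_spaceP _ _ mu x W (conj oW Wx).
have WS : mu (W `\` supp mu) = 0%E.
  apply: subset_measure0 (measurableD mW mS) (measurableC mS) _ _.
    by move=> y [].
  suff : mu (~` supp mu) = 0%E by [].
  by rewrite probability_setC// supp_full subee.
rewrite (measureDI mu mW mS) [X in (X + _)%E](_ : _ = 0%E)// add0e.
have -> // : W `&` supp mu = val @` ((val : supp_space mu -> X) @^-1` W).
apply/seteqP; split=> [y [Wy sy]|_ [y Wy <-]].
  by exists (exist _ y (mem_set sy)).
by split=> //; exact: supp_spaceP.
Qed.

Lemma supp_map_uniquely_invariant (T : X -> X) (cT : continuous T)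
    (mT : invariant_measures T mu) (nu : probability (borel (supp_space mu)) R) :
  (forall eta, invariant_measures T eta ->
    forall B : set (borel X), measurable B -> eta B = mu B) ->
  invariant_measures (supp_map cT mT) nu ->
  forall B : set (borel (supp_space mu)), measurable B ->
    nu B = supp_measure mu B.
Proof.
move=> mu_unique nuT B mB.
have mval := continuous_borel_measurable supp_val_continuous.
pose v : {mfun borel (supp_space mu) >-> borel X} := mfun_Sub (mem_set mval).
(* The inclusion [val] intertwines [supp_map] with [T], so it pushes [nu] forward to a [T]-invariant
   measure. *)
have etaT : invariant_measures T (distribution nu v).
  move=> C mC; rewrite /distribution /pushforward /=.
  rewrite -[RHS]nuT//; have := mval measurableT C mC.
  by rewrite setTI.
rewrite /supp_measure -(mu_unique _ etaT _ (supp_space_borel mB)).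
(* By injectivity of [val], the preimage of the image of [B] is [B] itself. *)
rewrite /distribution /pushforward /=; congr (nu _).
apply/seteqP; split=> [x Bx|x [y By /val_inj <-]//].
by exists x.
Qed.

End support_system.

Theorem theorem3p2 (R : realType) (X : compactMetricType R) (T : X -> X)
    (cT : continuous T) (ueT : uniquely_ergodic T)
    (mu : probability (borel X) R) (muE : ergodic_measures T mu) :
  WLDT T mu /\
  LDT (supp_map cT (ergodic_invariant muE)) (supp_measure mu).
Proof.
(* Both [eta] and [mu] are invariant, hence agree on Borel sets with the measure provided by unique
   ergodicity. *)
have mu_unique eta : invariant_measures T eta ->
    forall B : set (borel X), measurable B -> eta B = mu B.
  case: ueT => mu0 _ mu0P etaT B mB.
  by rewrite (mu0P _ etaT)// (mu0P _ (ergodic_invariant muE)).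
split; first exact: unique_invariant_WLDT.
split; last exact: supp_supp_measure.
apply: unique_invariant_WLDT; first exact: supp_map_continuous.
by move=> nu nuT; exact: supp_map_uniquely_invariant mu_unique nuT.
Qed.
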